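(* For every positive integer $t$, $\mathrm{SCH}_t$ is exactly as hard as $\mathrm{BDIS}_t$ with respect to the canonical error measures $(\mu_0,\mu_1)$.
   Context: Online problems with binary predictions: an instance is $I=(x,\hat x,r)$, $r=(r_1,\dots,r_n)$ requests, $x,\hat x\in\{0,1\}^n$; requests are revealed one at a time, with $r_i$ the deterministic online algorithm receives prediction $\hat x_i$ and must irrevocably output $y_i\in\{0,1\}$ before the next request; the unrevealed $x$ encodes an optimal solution. $\mathrm{Alg}(I),\mathrm{Opt}(I)$ denote profits. $\mu_0(I)=\sum_i x_i(1-\hat x_i)$, $\mu_1(I)=\sum_i(1-x_i)\hat x_i$. For $\alpha,\beta,\gamma\ge0$, an algorithm for a maximization problem is $(\alpha,\beta,\gamma)$-competitive w.r.t. $(\mu_0,\mu_1)$ if there is a constant $b$ with $\mathrm{Opt}(I)\le\alpha\mathrm{Alg}(I)+\beta\mu_0(I)+\gamma\mu_1(I)+b$ for all instances $I$. It is Pareto-optimal if for no $\varepsilon>0$ is there an $(\alpha-\varepsilon,\beta,\gamma)$-, $(\alpha,\beta-\varepsilon,\gamma)$- or $(\alpha,\beta,\gamma-\varepsilon)$-competitive algorithm. $Q$ is as hard as $P$ if for all $\alpha,\beta,\gamma$, an $(\alpha,\beta,\gamma)$-competitive Pareto-optimal algorithm for $Q$ implies an $(\alpha,\beta,\gamma)$-competitive algorithm for $P$; exactly as hard = both directions. $\mathrm{BDIS}_t$: vertex-arrival (request $r_i$ is a new vertex $v_i$ with all edges of the input graph $G$ to $v_1,\dots,v_{i-1}$),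 $G$ has maximum degree at most $t$; $y_i=0$ accepts $v_i$; $\{v_i:x_i=0\}$ is a maximum independent set; profit $\sum_i(1-y_i)$ if the accepted vertices are independent, else $-\infty$. $\mathrm{SCH}_t$: each request is an interval $s_i$; every requested interval overlaps at most $t$ other requested intervals; $y_i=0$ accepts $s_i$; $\{s_i:x_i=0\}$ is a maximum set of pairwise non-overlapping requested intervals; profit $\sum_i(1-y_i)$ if no two accepted intervals overlap, else $-\infty$. *)

(* Defs.v *)
From HB Require Import structures.
From mathcomp Require Import all_boot all_order all_algebra.
From mathcomp Require Import all_classical all_reals all_analysis.

Set Implicit Arguments.
Unset Strict Implicit.
Unset Printing Implicit Defensive.

Import Order.TTheory GRing.Theory Num.Theory.

Local Open Scope classical_set_scope.
Local Open Scope ring_scope.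

(* [true] and [false] stand for the bits 1 and 0 throughout. *)

Record problem (R : realType) := Problem {
  request : Type;
  legal : forall n, n.-tuple request -> Prop;
  encodes_opt : forall n, n.-tuple request -> n.-tuple bool -> Prop;
  profit : forall n, n.-tuple request -> n.-tuple bool -> \bar R
}.

Record instance (R : realType) (P : problem R) := Instance {
  size_of : nat;
  sol : size_of.-tuple bool;
  pred_of : size_of.-tuple bool;
  reqs : size_of.-tuple (request P);
  legal_reqs : legal reqs;
  sol_opt : encodes_opt reqs sol
}.

(* The algorithm maps the requests and predictions revealed so far, the current
   ones included, to its current output bit.  Its previous outputs are
   determined by this history, so they need not be arguments. *)
Definition algorithm (R : realType) (P : problem R) :=
  seq (request P * bool) -> bool.

Definition run (R : realType) (P : problem R) (A : algorithm P)
    (n : nat) (r : n.-tuple (request P)) (xhat : n.-tuple bool) :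
    n.-tuple bool :=
  [tuple A (take i.+1 (zip r xhat)) | i < n].

Definition Alg (R : realType) (P : problem R) (A : algorithm P)
    (I : instance P) : \bar R :=
  profit (reqs I) (run A (reqs I) (pred_of I)).

Definition Opt (R : realType) (P : problem R) (I : instance P) : \bar R :=
  \big[Order.max/-oo%E]_(y : (size_of I).-tuple bool) profit (reqs I) y.

Definition mu0 (R : realType) (P : problem R) (I : instance P) : nat :=
  (\sum_(i < size_of I) tnth (sol I) i * (1 - tnth (pred_of I) i))%N.

Definition mu1 (R : realType) (P : problem R) (I : instance P) : nat :=
  (\sum_(i < size_of I) (1 - tnth (sol I) i) * tnth (pred_of I) i)%N.

(* Competitiveness is only defined for nonnegative parameters; the three sign
   conditions make it false otherwise, which matters in [pareto_optimal].
   In [\bar R], [0 * -oo = 0], so for [alpha = 0] an infeasible output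
   would not by itself falsify the inequality. *)
Definition competitive (R : realType) (P : problem R) (alpha beta gamma : R)
    (A : algorithm P) : Prop :=
  [/\ 0 <= alpha, 0 <= beta, 0 <= gamma &
    exists b : R, forall I : instance P,
      (Opt I <= alpha%:E * Alg A I + (beta * (mu0 I)%:R)%:E
                + (gamma * (mu1 I)%:R)%:E + b%:E)%E].

Definition pareto_optimal (R : realType) (P : problem R)
    (alpha beta gamma : R) (A : algorithm P) : Prop :=
  competitive alpha beta gamma A /\
  forall eps : R, 0 < eps ->
    ~ exists B : algorithm P,
        [\/ competitive (alpha - eps) beta gamma B,
            competitive alpha (beta - eps) gamma B
          | competitive alpha beta (gamma - eps) B].

(* [as_hard Q P]: Q is as hard as P. *)
Definition as_hard (R : realType) (Q P : problem R) : Prop :=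
  forall alpha beta gamma : R,
    (exists A : algorithm Q, pareto_optimal alpha beta gamma A) ->
    exists B : algorithm P, competitive alpha beta gamma B.

Definition exactly_as_hard (R : realType) (Q P : problem R) : Prop :=
  as_hard Q P /\ as_hard P Q.

Definition independent (n : nat) (e : rel 'I_n) (S : {set 'I_n}) : bool :=
  [forall i in S, forall j in S, ~~ e i j].

Definition maximum_independent (n : nat) (e : rel 'I_n) (S : {set 'I_n}) :
    Prop :=
  independent e S /\
  forall S' : {set 'I_n}, independent e S' -> (#|S'| <= #|S|)%N.

Definition accepted (n : nat) (y : n.-tuple bool) : {set 'I_n} :=
  [set i | tnth y i == false]%SET.

Definition independent_profit (R : realType) (n : nat) (e : rel 'I_n)
    (y : n.-tuple bool) : \bar R :=
  if independent e (accepted y)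
  then (\sum_(i < n) (1 - tnth y i))%N%:R%:E else -oo%E.

(* The i-th request (counting from 0) is the row of i bits whose j-th bit tells
   whether the new vertex i is adjacent to the earlier vertex j. *)
Definition edge (n : nat) (r : n.-tuple bitseq) : rel 'I_n :=
  fun i j => if (j < i)%N then nth false (tnth r i) j
             else if (i < j)%N then nth false (tnth r j) i
             else false.

Definition BDIS_legal (t n : nat) (r : n.-tuple bitseq) : Prop :=
  (forall i : 'I_n, size (tnth r i) = i) /\
  (forall i : 'I_n, (#|[set j | edge r i j]%SET| <= t)%N).

Definition BDIS (R : realType) (t : nat) : problem R := {|
  request := bitseq;
  legal := BDIS_legal t;
  encodes_opt n r x := maximum_independent (edge r) (accepted x);
  profit n r y := independent_profit R (edge r) y
|}.

(* Distinct requests may be the same interval; they then overlap. *)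
Definition overlap (R : realType) (n : nat) (r : n.-tuple (interval R)) :
    rel 'I_n :=
  fun i j => (i != j) && ([set` tnth r i] `&` [set` tnth r j] != set0).

Definition SCH_legal (R : realType) (t n : nat) (r : n.-tuple (interval R)) :
    Prop :=
  (forall i : 'I_n, [set` tnth r i] !=set0) /\
  (forall i : 'I_n, (#|[set j | overlap r i j]%SET| <= t)%N).

Definition SCH (R : realType) (t : nat) : problem R := {|
  request := interval R;
  legal := @SCH_legal R t;
  encodes_opt n r x := maximum_independent (overlap r) (accepted x);
  profit n r y := independent_profit R (overlap r) y
|}.

(* Main.v *)
(* One direction runs a graph algorithm on the overlap graph of the intervals.
   For the other, an (alpha, beta, gamma)-competitive interval algorithm must
   satisfy 1 <= alpha, t <= alpha + beta, and t <= alpha or 1 <= gamma: present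
   many disjoint long intervals, all with the same prediction, and afterwards t
   disjoint points inside each long interval that was accepted.  On graphs these
   constraints are sufficient: if t <= alpha, accept greedily; otherwise accept
   greedily among the vertices predicted to be accepted.  Both algorithms are
   analysed by charging each optimal vertex that the prediction does not exclude
   to itself or to an accepted neighbour. *)

Require Import Defs.
From mathcomp Require Import all_boot all_order all_algebra.
From mathcomp Require Import all_classical all_reals all_analysis.
From mathcomp Require Import lra.

Set Implicit Arguments.
Unset Strict Implicit.
Unset Printing Implicit Defensive.

Import Order.TTheory GRing.Theory Num.Theory.

Local Open Scope ring_scope.

(** * Profits and error measures as cardinalities *)

Lemma in_accepted n (y : n.-tuple bool) i :
  (i \in accepted y) = ~~ tnth y i.
Proof. by rewrite inE eqbF_neg. Qed.

Lemma card_accepted n (y : n.-tuple bool) :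
  (\sum_(i < n) (1 - tnth y i))%N = #|accepted y|.
Proof.
rewrite -sum1_card [RHS]big_mkcond; apply: eq_bigr => i _.
by rewrite inE; case: (tnth y i).
Qed.

Lemma independent_profit_feasible (R : realType) n (e : rel 'I_n)
    (y : n.-tuple bool) :
  independent e (accepted y) ->
  independent_profit R e y = #|accepted y|%:R%:E.
Proof. by move=> iy; rewrite /independent_profit iy card_accepted. Qed.

(** Infeasible outputs contribute [-oo], so only independent sets compete in the maximum. *)
Lemma maximum_independent_profit (R : realType) n (e : rel 'I_n)
    (x : n.-tuple bool) : maximum_independent e (accepted x) ->
  \big[Order.max/-oo%E]_(y : n.-tuple bool) independent_profit R e y
    = #|accepted x|%:R%:E.
Proof.
move=> [ix xmax]; apply/eqP; rewrite eq_le; apply/andP; split.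
  elim/big_rec: _ => [|y v _ vle]; first exact: leNye.
  rewrite ge_max vle andbT /independent_profit.
  case: ifP => [/xmax le|_]; last exact: leNye.
  by rewrite card_accepted lee_fin ler_nat.
by rewrite -(independent_profit_feasible R ix); apply: le_bigmax.
Qed.

Lemma mu0_card (R : realType) (P : problem R) (I : instance P) :
  mu0 I = #|[set i | tnth (sol I) i && ~~ tnth (pred_of I) i]%SET|.
Proof.
rewrite -sum1_card [RHS]big_mkcond; apply: eq_bigr => i _.
by rewrite inE; case: (tnth (sol I) i); case: (tnth (pred_of I) i).
Qed.

Lemma mu1_card (R : realType) (P : problem R) (I : instance P) :
  mu1 I = #|[set i | ~~ tnth (sol I) i && tnth (pred_of I) i]%SET|.
Proof.
rewrite -sum1_card [RHS]big_mkcond; apply: eq_bigr => i _.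
by rewrite inE; case: (tnth (sol I) i); case: (tnth (pred_of I) i).
Qed.

(** * Simulating a graph algorithm on the overlap graph *)

Definition meets (R : realType) (u v : interval R) : bool :=
  ([set` u] `&` [set` v] != set0)%classic.

(** The default pair is never read: every index used is below [size h]. *)
Definition overlap_history (R : realType) (h : seq (interval R * bool)) :
    seq (bitseq * bool) :=
  let q i := nth (`]-oo, +oo[, false) h i in
  mkseq (fun i => (mkseq (fun j => meets (q i).1 (q j).1) i, (q i).2))
        (size h).

(** This makes the simulation online: entry [i] of the translation depends only on the first [i + 1]
    entries of [h]. *)
Lemma take_overlap_history (R : realType) k (h : seq (interval R * bool)) :
  take k (overlap_history h) = overlap_history (take k h).
Proof.
rewrite /overlap_history /mkseq -map_take take_iota size_take_min.
apply/eq_in_map => i; rewrite mem_iota /= add0n => ilt.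
have ik : (i < k)%N by apply: leq_trans ilt (geq_minl _ _).
rewrite nth_take //; congr pair; apply/eq_in_map => j.
rewrite mem_iota /= add0n => ji.
by rewrite nth_take // (ltn_trans ji).
Qed.

Section OverlapGraph.
Variables (R : realType) (n : nat) (r : n.-tuple (interval R)).

Definition overlap_row (i : 'I_n) : bitseq :=
  mkseq (fun j => meets (tnth r i) (nth `]-oo, +oo[ r j)) i.

Definition overlap_graph : n.-tuple bitseq := [tuple overlap_row i | i < n].

Lemma edge_overlap_graph : edge overlap_graph = overlap r.
Proof.
apply/funext => i; apply/funext => j; rewrite /edge /overlap !tnth_mktuple.
rewrite /overlap_row /meets -val_eqE; case: ltngtP => [ij|ij|//] /=.
- by rewrite nth_mkseq // (tnth_nth `]-oo, +oo[ r j).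
- by rewrite nth_mkseq // (tnth_nth `]-oo, +oo[ r i) classical_sets.setIC.
Qed.

Lemma zip_overlap_graph (xhat : n.-tuple bool) :
  zip overlap_graph xhat = overlap_history (zip r xhat).
Proof.
have szr : size (zip r xhat) = n by rewrite size_zip !size_tuple minnn.
apply: (@eq_from_nth _ ([::], false)).
  by rewrite /overlap_history size_mkseq szr size_zip !size_tuple minnn.
move=> i; rewrite size_zip !size_tuple minnn => lti.
rewrite /overlap_history nth_mkseq ?szr // !nth_zip ?size_tuple //=.
rewrite -(tnth_nth [::] overlap_graph (Ordinal lti)) tnth_mktuple /=.
congr pair; rewrite /overlap_row; apply/eq_in_map => j.
rewrite mem_iota /= add0n => ji.
by rewrite nth_zip ?size_tuple // (tnth_nth `]-oo, +oo[).
Qed.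

End OverlapGraph.

Section IntervalsAsGraph.
Variables (R : realType) (t : nat).

Definition graph_instance (I : instance (SCH R t)) : instance (BDIS R t).
Proof.
refine (@Instance R (BDIS R t) _ (sol I) (pred_of I) (overlap_graph (reqs I))
  _ _).
- case: (legal_reqs I) => _ deg; split=> i; rewrite ?edge_overlap_graph //.
  by rewrite tnth_mktuple size_mkseq.
- rewrite /= edge_overlap_graph; exact: (sol_opt I).
Defined.

(** An interval instance and its overlap graph share the conflict relation, the solution and the
    predictions. Hence optimum, profit and errors agree, and the additive constant carries over. *)
Lemma BDIS_as_hard_SCH : as_hard (BDIS R t) (SCH R t).
Proof.
move=> a b g [A [[a0 b0 g0 [c compA]] _]].
exists (fun h => A (overlap_history h)); split=> //; exists c => I.
have := compA (graph_instance I).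
rewrite /Opt /Alg /run /= edge_overlap_graph zip_overlap_graph.
by under eq_mktuple do rewrite take_overlap_history.
Qed.

End IntervalsAsGraph.

(** * Greedy algorithms on graphs *)

Definition accept_step (ok : pred bool) (ys : bitseq) (q : bitseq * bool) :
    bitseq :=
  rcons ys (~~ (ok q.2 &&
                all (fun j => nth false q.1 j ==> nth true ys j)
                    (iota 0 (size ys)))).

(* Accepts a vertex whenever its prediction satisfies [ok] and no earlier
   neighbour has been accepted. *)
Definition greedy (ok : pred bool) (h : seq (bitseq * bool)) : bool :=
  last true (foldl (accept_step ok) [::] h).

Section Greedy.
Variables (R : realType) (t : nat) (ok : pred bool).

Lemma size_foldl_accept_step h :
  size (foldl (accept_step ok) [::] h) = size h.
Proof.
by elim/last_ind: h => // h q IH; rewrite foldl_rcons !size_rcons IH.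
Qed.

(** An [algorithm] is not given its past outputs, so [greedy] recomputes them; the recomputed bits
    are those it issued on the prefixes. *)
Lemma nth_foldl_accept_step h i : (i < size h)%N ->
  nth true (foldl (accept_step ok) [::] h) i
    = greedy ok (take i.+1 h).
Proof.
elim/last_ind: h => // h q IH; rewrite size_rcons ltnS leq_eqVlt.
rewrite /greedy -cats1 => /orP[/eqP ->|lti].
  rewrite take_oversize ?size_cat ?addn1 // cats1 foldl_rcons last_rcons.
  by rewrite nth_rcons size_foldl_accept_step ltnn eqxx.
rewrite takel_cat // cats1 foldl_rcons nth_rcons size_foldl_accept_step lti.
exact: IH.
Qed.

Lemma greedyE n (r : n.-tuple bitseq) (xhat : n.-tuple bool) (i : 'I_n) :
  let y := run (greedy ok : algorithm (BDIS R t)) r xhat in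
  tnth y i = ~~ (ok (tnth xhat i) &&
                 [forall j : 'I_n, (j < i)%N && edge r i j ==> tnth y j]).
Proof.
move=> y.
have szr : size (zip r xhat) = n by rewrite size_zip !size_tuple minnn.
have yE (j : 'I_n) :
    tnth y j = nth true (foldl (accept_step ok) [::] (zip r xhat)) j.
  by rewrite tnth_mktuple nth_foldl_accept_step // szr.
rewrite tnth_mktuple (take_nth ([::], false)) ?szr // /greedy foldl_rcons.
rewrite last_rcons nth_zip ?size_tuple //= -!tnth_nth; congr (~~ (_ && _)).
rewrite size_foldl_accept_step size_take szr ltn_ord.
apply/allP/forallP => [H j|H j].
  apply/implyP => /andP[ji]; rewrite /edge ji => e.
  have := H j; rewrite mem_iota /= add0n ji e /= => /(_ isT).
  rewrite yE !nth_foldl_accept_step ?szr ?size_take ?szr ?ltn_ord //.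
  by rewrite take_takel.
rewrite mem_iota /= add0n => ji; have jn := ltn_trans ji (ltn_ord i).
apply/implyP => e; have /implyP := H (Ordinal jn).
rewrite /edge /= ji e yE /= => /(_ isT).
rewrite !nth_foldl_accept_step ?szr ?size_take ?szr ?ltn_ord //.
by rewrite take_takel.
Qed.

End Greedy.

Lemma leq_card_bigcup (T I : finType) (A : pred I) (F : I -> {set T}) k :
  (forall i, A i -> #|F i| <= k)%N ->
  (#|\bigcup_(i in A) F i| <= k * #|A|)%N.
Proof.
move=> Fk; rewrite mulnC -sum_nat_const.
elim/big_ind2: _ => [|B1 m1 B2 m2 h1 h2|i /Fk //]; first by rewrite cards0.
by apply: leq_trans (leq_add h1 h2); rewrite leq_card_setU.
Qed.

Lemma edge_sym n (r : n.-tuple bitseq) : symmetric (edge r).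
Proof. by move=> i j; rewrite /edge; case: ltngtP. Qed.

Lemma edge_irr n (r : n.-tuple bitseq) : irreflexive (edge r).
Proof. by move=> i; rewrite /edge ltnn. Qed.

Section GreedyBound.
Variables (n t : nat) (e : rel 'I_n) (ok : pred 'I_n).
Hypotheses (esym : symmetric e) (eirr : irreflexive e).
Hypothesis edeg : forall i, (#|[set j | e i j]%SET| <= t)%N.
Variables x y : n.-tuple bool.
Hypothesis yE : forall i,
  tnth y i = ~~ (ok i && [forall j : 'I_n, (j < i)%N && e i j ==> tnth y j]).

Let X := accepted x.
Let Y := accepted y.

Lemma greedy_independent : independent e Y.
Proof.
have no_edge (i j : 'I_n) : i \in Y -> j \in Y -> (j < i)%N -> ~~ e i j.
  rewrite !in_accepted yE negbK => /andP[_ /forallP/(_ j)] + /negbTE yj lt.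
  by rewrite lt yj; case: (e i j).
apply/forall_inP => i iY; apply/forall_inP => j jY.
case: (ltngtP j i) => [lt|lt|/val_inj ->]; last by rewrite eirr.
- exact: no_edge.
- by rewrite esym no_edge.
Qed.

(** A vertex of [X] that satisfies [ok] but is rejected has an accepted earlier neighbour. As [X] is
    independent, that neighbour lies outside [X], and it is charged at most [t] times. *)
Lemma greedy_cover : independent e X ->
  (#|[set i in X | ok i]%SET| <= #|Y :&: X| + t * #|Y :\: X|)%N.
Proof.
move=> iX; set N := (\bigcup_(v in Y :\: X) [set j | e v j])%SET.
have sub : [set i in X | ok i]%SET \subset (Y :&: X) :|: N.
  apply/fintype.subsetP => i; rewrite inE => /andP[iXi oki].
  rewrite finset.in_setU finset.in_setI iXi andbT in_accepted.
  have [yi|//] := boolP (tnth y i).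
  move: (yi); rewrite yE oki /= => /forallPn[j].
  rewrite negb_imply => /andP[/andP[_ eij] yj].
  apply/finset.bigcupP; exists j; last by rewrite inE esym.
  rewrite finset.in_setD !in_accepted yj andbT; apply: contraL eij => xj.
  by move: iX => /forall_inP/(_ i iXi)/forall_inP; apply; rewrite in_accepted.
apply: leq_trans (subset_leq_card sub) _.
apply: leq_trans (leq_card_setU _ _) _; rewrite leq_add2l.
by apply: leq_card_bigcup => v _; exact: edeg.
Qed.

End GreedyBound.

(** * Competitiveness of the two greedy algorithms *)

Section GreedyCompetitive.
Variables (R : realType) (t : nat) (ok : pred bool) (I : instance (BDIS R t)).

Let A : algorithm (BDIS R t) := greedy ok.
Let y := run A (reqs I) (pred_of I).
Let X := accepted (sol I).
Let Y := accepted y.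

Lemma Opt_BDIS : Opt I = #|X|%:R%:E.
Proof. exact: maximum_independent_profit (sol_opt I). Qed.

Let yE (i : 'I_(size_of I)) : tnth y i = _ := greedyE R t ok _ _ i.

Lemma Alg_greedy : Alg A I = #|Y|%:R%:E.
Proof.
apply: independent_profit_feasible.
exact: (greedy_independent (@edge_sym _ _) (@edge_irr _ _) yE).
Qed.

Lemma greedy_ok i : i \in Y -> ok (tnth (pred_of I) i).
Proof. by rewrite in_accepted yE negbK => /andP[]. Qed.

Lemma greedy_bound :
  (#|[set i in X | ok (tnth (pred_of I) i)]%SET|
     <= #|Y :&: X| + t * #|Y :\: X|)%N.
Proof.
have [_ deg] := legal_reqs I; have [iX _] := sol_opt I.
exact: (greedy_cover (@edge_sym _ _) deg yE).
Qed.

End GreedyCompetitive.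

(** With [predT] no optimal vertex is excluded, and [t >= 1] lets the accepted optimal vertices be
    counted [t] times as well. *)
Lemma accept_all_competitive (R : realType) t (a b g : R) :
  (0 < t)%N -> t%:R <= a -> 0 <= b -> 0 <= g ->
  competitive a b g (greedy predT : algorithm (BDIS R t)).
Proof.
move=> t0 ta b0 g0; split=> //; first exact: le_trans ta.
exists 0 => I; rewrite Opt_BDIS Alg_greedy -!EFinM -!EFinD lee_fin.
have := greedy_bound predT I.
set X := accepted (sol I); set Y := accepted _ => le.
have {}le : (#|X| <= t * #|Y|)%N.
  have XE : [set i in X | predT (tnth (pred_of I) i)]%SET = X.
    by apply/finset.setP => i; rewrite !inE andbT.
  rewrite XE in le; rewrite -(cardsID X Y) mulnDr.
  by apply: leq_trans le _; rewrite leq_add2r leq_pmull.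
move: le; rewrite -(ler_nat R) natrM => le.
have : t%:R * #|Y|%:R <= a * #|Y|%:R by apply: ler_wpM2r.
have : 0 <= b * (mu0 I)%:R by apply: mulr_ge0.
have : 0 <= g * (mu1 I)%:R by apply: mulr_ge0.
lra.
Qed.

(** Accepted vertices outside the optimum were wrongly predicted 0, so [mu0] counts them; optimal
    vertices predicted 1 are counted by [mu1]. *)
Lemma follow_competitive (R : realType) t (a b g : R) :
  1 <= a <= t%:R -> 0 <= b -> 1 <= g -> t%:R <= a + b ->
  competitive a b g (greedy negb : algorithm (BDIS R t)).
Proof.
move=> /andP[a1 at_] b0 g1 tab.
split=> //; [exact: le_trans a1|exact: le_trans g1|].
exists 0 => I; rewrite Opt_BDIS Alg_greedy -!EFinM -!EFinD lee_fin.
have := greedy_bound negb I; have := @greedy_ok R t negb I.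
set X := accepted (sol I); set Y := accepted _ => okY le.
have YX0 : (#|Y :\: X| <= mu0 I)%N.
  rewrite mu0_card; apply/subset_leq_card/fintype.subsetP => i.
  rewrite finset.in_setD in_accepted negbK => /andP[xi yi].
  by rewrite inE xi okY.
have X1 : (#|X| <= #|[set i in X | ~~ tnth (pred_of I) i]%SET| + mu1 I)%N.
  rewrite mu1_card; apply: leq_trans (leq_card_setU _ _).
  apply/subset_leq_card/fintype.subsetP => i; rewrite !inE => xi.
  by rewrite xi (eqP xi); case: (tnth _ i).
have {}le : (#|X| <= #|Y :&: X| + t * #|Y :\: X| + mu1 I)%N.
  by apply: leq_trans X1 _; rewrite leq_add2r.
rewrite -(cardsID X Y) natrD.
move: le YX0; rewrite -!(ler_nat R) !natrD natrM.
set c : R := #|Y :&: X|%:R; set w : R := #|Y :\: X|%:R.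
set u : R := (mu0 I)%:R; set v : R := (mu1 I)%:R => le wu.
have c0 : 0 <= c by []. have w0 : 0 <= w by []. have v0 : 0 <= v by [].
(* Split [t * w] as [a * w + (t - a) * w]; since [t - a <= b] and [w <= u], the second term is at
   most [b * u]. *)
nra.
Qed.

(** * The adversary for interval scheduling *)

Lemma card_set_tnth n (T : eqType) (s : n.-tuple T) (P : pred T) :
  #|[set i | P (tnth s i)]%SET| = count P s.
Proof.
rewrite -sum1_card -sum1_count big_tuple.
by apply: eq_bigl => i; rewrite inE.
Qed.

(** Used with [f := id] to bound degrees, and with a swapping map to bound independent sets. *)
Lemma leq_card_tnth n (T : eqType) (s : n.-tuple T) (S : {set 'I_n})
    (f : T -> T) (l : seq T) :
  {in S &, injective (fun i => f (tnth s i))} ->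
  (forall i, i \in S -> f (tnth s i) \in l) -> (#|S| <= size l)%N.
Proof.
move=> inj sub; rewrite cardE -(size_map (fun i => f (tnth s i))).
apply: uniq_leq_size.
  rewrite map_inj_in_uniq ?enum_uniq // => i j.
  by rewrite !mem_enum; exact: inj.
by move=> _ /mapP[i + ->]; rewrite mem_enum; exact: sub.
Qed.

(** Each block index below [m] is the quotient of exactly [t] numbers below [m * t]; the induction
    peels off the last block. *)
Lemma count_divn_iota (a : pred nat) t m : (0 < t)%N ->
  count (fun q => a (q %/ t)%N) (iota 0 (m * t)) = (count a (iota 0 m) * t)%N.
Proof.
move=> t0; elim: m => [|m IH]; first by rewrite mul0n.
rewrite -[in RHS]addn1 mulSn addnC !iotaD !count_cat IH !add0n mulnDl.
congr addn; rewrite /= addn0.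
rewrite (@eq_in_count _ _ (fun=> a m)) => [|q].
  by case: (a m); rewrite ?count_predT ?count_pred0 ?size_iota ?mul1n ?mul0n.
rewrite mem_iota => /andP[lo hi]; congr a.
apply/eqP; rewrite eqn_leq leq_divRL // lo andbT -ltnS ltn_divLR //.
by rewrite mulSn addnC.
Qed.

(* The requests of the adversary: [inl b] is the b-th long interval and [inr q]
   the point q, which lies in the long interval [q %/ t]. *)
Section Adversary.
Variables (R : realType) (t : nat).
Hypothesis t0 : (0 < t)%N.

(** Long intervals are half-open, so that consecutive ones are disjoint and each point lies in just
    one of them. *)
Definition item_interval (u : nat + nat) : interval R :=
  match u with
  | inl b => `[(b * t)%N%:R, (b.+1 * t)%N%:R[
  | inr q => `[q%:R, q%:R]
  end.

Definition conflict (u v : nat + nat) : bool :=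
  match u, v with
  | inl b, inl c => b == c
  | inl b, inr q | inr q, inl b => (q %/ t == b)%N
  | inr p, inr q => p == q
  end.

Lemma meets_sym (u v : interval R) : meets u v = meets v u.
Proof. by rewrite /meets classical_sets.setIC. Qed.

Lemma meets_long_point b q :
  meets (item_interval (inl b)) (item_interval (inr q)) = (q %/ t == b)%N.
Proof.
have -> : (q %/ t == b)%N = (b * t <= q < b.+1 * t)%N.
  by rewrite eqn_leq -leq_divRL // -ltn_divLR // ltnS andbC.
apply/idP/idP => [/set0P[z [/=]]|qb].
  rewrite !in_itv /= => /andP[lo hi] /andP[qz zq].
  have zE : z = q%:R by apply/eqP; rewrite eq_le qz zq.
  by move: lo hi; rewrite zE ler_nat ltr_nat => -> ->.
apply/set0P; exists q%:R; split=> /=; rewrite in_itv /= ?lexx //.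
by rewrite ler_nat ltr_nat.
Qed.

Lemma meets_item u v :
  meets (item_interval u) (item_interval v) = conflict u v.
Proof.
case: u v => [b|p] [c|q].
- apply/idP/eqP => [/set0P[z [/=]]|<-].
    rewrite !in_itv /= => /andP[bz zb] /andP[cz zc].
    have := le_lt_trans bz zc; have := le_lt_trans cz zb.
    rewrite !ltr_nat !ltn_pmul2r // !ltnS => cb bc.
    by apply/eqP; rewrite eqn_leq bc cb.
  apply/set0P; exists (b * t)%N%:R; split=> /=;
    by rewrite in_itv /= lexx ltr_nat ltn_pmul2r // ltnSn.
- exact: meets_long_point.
- by rewrite meets_sym meets_long_point.
- apply/idP/eqP => [/set0P[z [/=]]|<-].
    rewrite !in_itv /= => /andP[pz zp] /andP[qz zq].
    apply/eqP; rewrite -(eqr_nat R).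
    by rewrite eq_le (le_trans pz zq) (le_trans qz zp).
  by apply/set0P; exists p%:R; split=> /=; rewrite in_itv /= lexx.
Qed.

Variables (m : nat) (a : pred nat) (p : bool).

Let k := count a (iota 0 m).
Let points := [seq q <- iota 0 (m * t)%N | a (q %/ t)%N].

Lemma size_points : size points = (k * t)%N.
Proof. by rewrite size_filter count_divn_iota. Qed.

(** The blocks that receive points are given by an arbitrary [a]; the lower bounds later take for
    [a] the long intervals that the algorithm accepts. *)
Definition items : seq (nat + nat) := map inl (iota 0 m) ++ map inr points.

Lemma items_uniq : uniq items.
Proof.
rewrite cat_uniq !map_inj_uniq ?filter_uniq ?iota_uniq //;
  try by move=> u v [].
by rewrite andbT; apply/hasPn => _ /mapP[q _ ->]; apply/mapP => -[].
Qed.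

Lemma mem_items_long b : (inl b \in items) = (b < m)%N.
Proof.
rewrite mem_cat mem_map; last by move=> u v [].
rewrite mem_iota /= add0n; case: ltnP => //= _.
by apply/mapP => -[].
Qed.

Lemma mem_items_point q : (inr q \in items) = a (q %/ t)%N && (q %/ t < m)%N.
Proof.
rewrite mem_cat orbC mem_map; last by move=> u v [].
rewrite mem_filter mem_iota /= add0n ltn_divLR //.
by rewrite [X in _ || X](_ : _ = false) ?orbF //; apply/mapP => -[].
Qed.

Definition item_sol (u : nat + nat) := if u is inl b then a b else false.
(** Points are predicted correctly, so only long intervals contribute to the errors. *)
Definition item_pred (u : nat + nat) := if u is inl b then p else false.

Let n := size items.
Let T : n.-tuple (nat + nat) := in_tuple items.

Let item_inj : injective (tnth T).
Proof. by apply/tuple_uniqP; exact: items_uniq. Qed.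

Let item_mem i : tnth T i \in items.
Proof. exact: mem_tnth. Qed.

Definition adv_reqs : n.-tuple (interval R) := map_tuple item_interval T.
Definition adv_sol : n.-tuple bool := map_tuple item_sol T.
Definition adv_pred : n.-tuple bool := map_tuple item_pred T.

Lemma overlap_adv i j :
  overlap adv_reqs i j = (i != j) && conflict (tnth T i) (tnth T j).
Proof.
by rewrite /overlap !tnth_map -[(_ != _ :> set _)]/(meets _ _) meets_item.
Qed.

Lemma adv_legal : SCH_legal t adv_reqs.
Proof.
split=> i.
  apply/set0P; have := meets_item (tnth T i) (tnth T i).
  rewrite tnth_map /meets classical_sets.setIid => ->.
  by case: (tnth T i) => b /=; rewrite eqxx.
(* [l] lists all candidates for a neighbour of item [i]: the [t] points of its block, or the single
   long interval around it. The last branch is unreachable. *)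
pose l := if tnth T i is inr q then [:: inl (q %/ t)%N]
          else if tnth T i is inl b then map inr (iota (b * t)%N t) else [::].
have lt : (size l <= t)%N.
  by rewrite /l; case: (tnth T i) => b //; rewrite size_map size_iota.
apply: leq_trans lt; apply: (@leq_card_tnth _ _ T _ id).
  by move=> j j' _ _; exact: item_inj.
move=> j; rewrite inE overlap_adv /l => /andP[ij].
have : tnth T i != tnth T j by rewrite (inj_eq item_inj).
case: (tnth T i) (tnth T j) => [b|q] [c|q'] //=.
- by move=> /negP ne /eqP bc; case: ne; rewrite bc.
- move=> _ /eqP <-; rewrite mem_map; last by move=> u v [].
  by rewrite mem_iota leq_divM /= addnC -mulSn ltn_ceil.
- by move=> _ /eqP <-; rewrite mem_seq1.
- by move=> /negP ne /eqP bc; case: ne; rewrite bc.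
Qed.

Let card_sol : #|accepted adv_sol| = (k * t + (m - k))%N.
Proof.
have -> : accepted adv_sol = [set i | ~~ item_sol (tnth T i)]%SET.
  by apply/finset.setP => i; rewrite in_accepted inE tnth_map.
rewrite (card_set_tnth T (predC item_sol)) count_cat !count_map.
rewrite -size_points [RHS]addnC.
congr (_ + _)%N.
by rewrite -[m in RHS](size_iota 0) -(count_predC a) addKn.
Qed.

(* A maximum solution cannot beat the optimum of each block: swapping a long
   interval of an accepted block for its first point is injective on
   independent sets. *)
Lemma adv_sol_opt : maximum_independent (overlap adv_reqs) (accepted adv_sol).
Proof.
split.
  apply/forall_inP => i; rewrite in_accepted tnth_map => si.
  apply/forall_inP => j; rewrite in_accepted tnth_map => sj.
  rewrite overlap_adv; apply/negP => /andP[]; rewrite -(inj_eq item_inj).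
  move: si sj (item_mem i) (item_mem j).
  case: (tnth T i) (tnth T j) => [b|q] [c|q'] //=.
  - by move=> _ _ _ _ /negP ne /eqP bc; case: ne; rewrite bc.
  - move=> nb _ _; rewrite mem_items_point => /andP[+ _] _ /eqP bc.
    by rewrite bc (negbTE nb).
  - move=> _ nb; rewrite mem_items_point => /andP[+ _] _ _ /eqP bc.
    by rewrite bc (negbTE nb).
  - by move=> _ _ _ _ /negP ne /eqP bc; case: ne; rewrite bc.
move=> S indS.
pose f u : nat + nat :=
  if u is inl b then if a b then inr (b * t)%N else u else u.
have -> : #|accepted adv_sol| = size [seq u <- items | ~~ item_sol u].
  rewrite size_filter -(card_set_tnth T); apply: eq_card => i.
  by rewrite in_accepted inE tnth_map.
apply: (@leq_card_tnth _ _ T _ f) => [i j iS jS fij|i iS]; last first.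
  rewrite mem_filter; move: (item_mem i); rewrite /f.
  case: (tnth T i) => [b|q] //=; rewrite mem_items_long => bm.
  case: ifP => ab //=; rewrite ?ab ?mem_items_long //.
  by rewrite mem_items_point mulnK // ab.
(* Two items with the same image under [f] are equal or are a long interval and the first point of
   its block. Either way [conflict] holds, against independence. *)
apply/eqP; apply: contraT => ij; move: indS => /forall_inP/(_ i iS).
move=> /forall_inP/(_ j jS); rewrite overlap_adv ij /=.
move: fij; rewrite /f; case: (tnth T i) (tnth T j) => [b|q] [c|q'] /=.
- case: ifP => _; case: ifP => _ // []; last by move=> ->; rewrite eqxx.
  by move=> /eqP; rewrite eqn_pmul2r // => ->.
- by case: ifP => _ // [<-]; rewrite mulnK ?eqxx.
- by case: ifP => _ // [->]; rewrite mulnK ?eqxx.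
- by move=> [->]; rewrite eqxx.
Qed.

Definition adv : instance (SCH R t) :=
  @Instance R (SCH R t) n adv_sol adv_pred adv_reqs adv_legal adv_sol_opt.

Lemma Opt_adv : Opt adv = (k * t + (m - k))%N%:R%:E.
Proof. by rewrite -card_sol; exact: maximum_independent_profit adv_sol_opt. Qed.

Lemma mu0_adv : mu0 adv = if p then 0%N else k.
Proof.
rewrite mu0_card /=.
have -> : [set i | tnth adv_sol i && ~~ tnth adv_pred i]%SET =
          [set i | [pred u | item_sol u && ~~ item_pred u] (tnth T i)]%SET.
  by apply/finset.setP => i; rewrite !inE !tnth_map.
rewrite (card_set_tnth T) count_cat !count_map.
rewrite [X in (_ + X)%N](_ : _ = 0%N) ?addn0; last exact: count_pred0.
rewrite /item_pred; case: p; last by apply: eq_count => b /=; rewrite andbT.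
by rewrite (@eq_count _ _ pred0) ?count_pred0 // => b /=; rewrite andbF.
Qed.

Lemma mu1_adv : mu1 adv = if p then (m - k)%N else 0%N.
Proof.
rewrite mu1_card /=.
have -> : [set i | ~~ tnth adv_sol i && tnth adv_pred i]%SET =
          [set i | [pred u | ~~ item_sol u && item_pred u] (tnth T i)]%SET.
  by apply/finset.setP => i; rewrite !inE !tnth_map.
rewrite (card_set_tnth T) count_cat !count_map.
rewrite [X in (_ + X)%N](_ : _ = 0%N) ?addn0; last exact: count_pred0.
rewrite /item_pred; case: p; last first.
  by rewrite (@eq_count _ _ pred0) ?count_pred0 // => b /=; rewrite andbF.
rewrite -[m in RHS](size_iota 0) -(count_predC a) addKn.
by apply: eq_count => b /=; rewrite andbT.
Qed.

(** All long intervals precede all points, so the answer on one of them does not depend on [a]. This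
    is why [a] may be defined from the answers of [A] without circularity. *)
Lemma run_adv_long (A : algorithm (SCH R t)) (i : 'I_n) b :
  tnth T i = inl b ->
  tnth (run A adv_reqs adv_pred) i =
    A (mkseq (fun c => (item_interval (inl c), p)) b.+1).
Proof.
move=> Ti.
have bm : (b < m)%N by rewrite -mem_items_long -Ti.
have ib : nat_of_ord i = b.
  have bn : (b < n)%N by rewrite /n size_cat size_map size_iota ltn_addr.
  suff -> : i = Ordinal bn by [].
  apply: item_inj; rewrite Ti (tnth_nth (inl 0%N)) /=.
  by rewrite nth_cat size_map size_iota bm (nth_map 0%N) ?size_iota // nth_iota.
rewrite tnth_mktuple ib; congr A.
rewrite /= zip_map -map_take take_cat size_map size_iota.
case: ltnP => [lt|ge].
  by rewrite -map_take take_iota (minn_idPl (ltnW lt)) -!map_comp.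
(* Here [b] is the last long interval, and the prefix stops just before the first point. *)
have -> : m = b.+1 by apply/eqP; rewrite eqn_leq ge bm.
by rewrite subnn take0 cats0 -!map_comp.
Qed.

End Adversary.

(** * Necessary conditions on the parameters *)

Section LowerBounds.
Variables (R : realType) (t : nat).
Hypothesis t0 : (0 < t)%N.

Lemma independent_profit_le n (e : rel 'I_n) (y : n.-tuple bool) k :
  (independent e (accepted y) -> (#|accepted y| <= k)%N) ->
  (independent_profit R e y <= k%:R%:E)%E.
Proof.
rewrite /independent_profit; case: ifP => [_ /(_ isT) le|_ _];
  last exact: leNye.
by rewrite card_accepted lee_fin ler_nat.
Qed.

Definition accepts_long (A : algorithm (SCH R t)) (p : bool) : pred nat :=
  fun b => ~~ A (mkseq (fun c => (item_interval R t (inl c), p)) b.+1).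

(* Whatever A accepts is a long interval, since every point of the adversary
   lies in a long interval that A has accepted. *)
Lemma Alg_adv_le A m p (a := accepts_long A p) :
  (Alg A (adv R t0 m a p) <= (count a (iota 0 m))%:R%:E)%E.
Proof.
apply: independent_profit_le => /= indy.
set T := in_tuple (items t m a).
pose good (u : nat + nat) := if u is inl b then a b else false.
have -> : count a (iota 0 m) = #|[set i | good (tnth T i)]%SET|.
  rewrite card_set_tnth count_cat !count_map.
  rewrite [X in (_ + X)%N](_ : _ = 0%N) ?addn0 //; exact: count_pred0.
apply/subset_leq_card/fintype.subsetP => i iY; rewrite inE.
case Ti : (tnth T i) => [b|q] /=.
  by move: iY; rewrite in_accepted (run_adv_long p A Ti).
have : inr q \in items t m a by rewrite -Ti mem_tnth.
rewrite (mem_items_point t0) => /andP[aq qm].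
have /tnthP[j Tj] : inl (q %/ t)%N \in T by rewrite mem_items_long.
have jY : j \in accepted (run A (adv_reqs R t m a) (adv_pred t m a p)).
  by rewrite in_accepted (run_adv_long p A (esym Tj)).
move: indy => /forall_inP/(_ i iY)/forall_inP/(_ j jY).
rewrite overlap_adv // -/T Ti -Tj /= eqxx andbT negbK => /eqP ij.
by move: Tj; rewrite -ij Ti.
Qed.

(** Whatever the split [k], the sum is at least [m * min(u, v)], which exceeds [b] for large [m]. *)
Lemma unbounded_combination (u v b : R) : 0 < u -> 0 < v ->
  ~ forall m, exists2 k, (k <= m)%N & k%:R * u + (m - k)%:R * v <= b.
Proof.
move=> u0 v0 bounded.
pose w := Num.min u v; have w0 : 0 < w by rewrite lt_min u0 v0.
have /(_ (Num.bound `|b / w|))[k km] := bounded.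
set m := Num.bound _ in km *; apply/negP; rewrite -ltNge.
have lt : b < m%:R * w.
  rewrite -ltr_pdivrMr //; apply: le_lt_trans (ler_norm _) _.
  exact: archi_boundP.
apply: lt_le_trans lt _; rewrite -{1}(subnKC km) natrD mulrDl.
by apply: lerD; apply: ler_wpM2l => //; rewrite ge_min lexx ?orbT.
Qed.

Variables (alpha beta gamma : R) (A : algorithm (SCH R t)).
Hypothesis compA : competitive alpha beta gamma A.

(** Present [m] disjoint long intervals, no points, and correct predictions: the optimum is [m], the
    profit at most [m], and both errors vanish. *)
Lemma competitive_ge1 : 1 <= alpha.
Proof.
have [a0 _ _ [b bP]] := compA.
case: leP => // alt1; exfalso.
have u0 : 0 < 1 - alpha by rewrite subr_gt0.
apply: (@unbounded_combination (1 - alpha) (1 - alpha) b) => // m.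
exists 0%N => //; rewrite mul0r add0r subn0.
have := bP (adv R t0 m pred0 false).
rewrite Opt_adv mu0_adv mu1_adv count_pred0 mul0n subn0 !mulr0 !adde0 add0n.
have Am : (Alg A (adv R t0 m pred0 false) <= m%:R%:E)%E.
  apply: independent_profit_le => _; apply: leq_trans (max_card _) _.
  rewrite card_ord /= size_cat !size_map size_iota.
  by rewrite (@eq_filter _ _ pred0) // filter_pred0 addn0.
have := lee_wpmul2l (_ : (0 <= alpha%:E)%E) Am; rewrite lee_fin => /(_ a0) le.
move=> /le_trans/(_ (leeD2r _ le)); rewrite -EFinM -EFinD lee_fin.
lra.
Qed.

(** Here [k] is the number of long intervals that [A] accepts out of [m] when all are predicted [p];
    it may vary with [m] and [p], while [b] may not. *)
Lemma adversary_bound : exists b : R, forall m p, exists2 k, (k <= m)%N &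
  k%:R * t%:R + (m - k)%:R <=
    alpha * k%:R + (if p then gamma * (m - k)%:R else beta * k%:R) + b.
Proof.
have [a0 _ _ [b bP]] := compA; exists b => m p.
pose a := accepts_long A p.
exists (count a (iota 0 m)); first by rewrite -{2}(size_iota 0 m) count_size.
have := bP (adv R t0 m a p); rewrite Opt_adv mu0_adv mu1_adv.
have := lee_wpmul2l (_ : (0 <= alpha%:E)%E) (Alg_adv_le A m p).
rewrite lee_fin -/a => /(_ a0) le.
move=> /le_trans/(_ (leeD2r _ (leeD2r _ (leeD2r _ le)))).
rewrite -EFinM -!EFinD lee_fin natrD natrM => {}le.
by apply: le_trans le _; case: (p); rewrite !mulr0 ?addr0.
Qed.

(** With prediction 0, accepted long intervals have excess [t - (alpha + beta)] and rejected ones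
    excess 1. *)
Lemma competitive_le_add_beta : t%:R <= alpha + beta.
Proof.
have [b bP] := adversary_bound.
case: leP => // lt; exfalso.
apply: (@unbounded_combination (t%:R - (alpha + beta)) 1 b) => // [|m].
  by rewrite subr_gt0.
by have [k km le] := bP m false; exists k => //; lra.
Qed.

(** With prediction 1, the excesses are [t - alpha] and [1 - gamma], which cannot both be
    positive. *)
Lemma competitive_le_alpha_or_gamma : t%:R <= alpha \/ 1 <= gamma.
Proof.
have [b bP] := adversary_bound.
case: (leP t%:R alpha) => [|lta]; first by left.
case: (leP 1 gamma) => [|ltg]; first by right.
exfalso; apply: (@unbounded_combination (t%:R - alpha) (1 - gamma) b) => [||m];
  rewrite ?subr_gt0 //.
by have [k km le] := bP m true; exists k => //; lra.
Qed.

End LowerBounds.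

Theorem theorem4p13 (R : realType) (t : nat) (ht : (0 < t)%N) :
  exactly_as_hard (SCH R t) (BDIS R t).
Proof.
split; last exact: BDIS_as_hard_SCH.
move=> a b g [A [compA _]]; have [_ b0 g0 _] := compA.
case: (leP t%:R a) => [ta|at_].
  by exists (greedy predT); apply: accept_all_competitive.
exists (greedy negb); apply: follow_competitive => //.
- by rewrite (competitive_ge1 ht compA) ltW.
- by have [|//] := competitive_le_alpha_or_gamma ht compA; rewrite leNgt at_.
- exact: competitive_le_add_beta compA.
Qed.
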